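(* Let $\mathfrak{s}$ be a real completely solvable Lie algebra with $\dim(\mathfrak{s})\ge 3$ and Lie bracket $\mu$. Then there exists a left-invariant pseudo-Riemannian metric on the corresponding Lie group, equivalently a non-degenerate symmetric bilinear form $g$ on $\mathfrak{s}$, of signature $(p,p)$ if $\dim(\mathfrak{s})=2p$ is even, and of signature $(p,p+1)$ if $\dim(\mathfrak{s})=2p+1$ is odd, such that $\mu$ is in the null cone $\mathcal{N}$ of the action of the orthogonal group of $g$.
   Context: All Lie algebras are real and finite-dimensional. A Lie algebra $\mathfrak{s}$ of dimension $n$ is completely solvable if there is a sequence $\mathfrak{s}=\mathfrak{a}_0\supset\mathfrak{a}_1\supset\dots\supset\mathfrak{a}_n=0$ of ideals of $\mathfrak{s}$ with $\dim(\mathfrak{a}_i/\mathfrak{a}_{i+1})=1$ for all $i$. Left-invariant pseudo-Riemannian metrics on a Lie group correspond to non-degenerate symmetric bilinear forms on its Lie algebra. Given such a form $g$ of signature $(p,q)$ on a real vector space $V$ of dimension $p+q$, the group $O(p,q)$ of linear isometries of $(V,g)$ acts on $\mathcal{V}:=V\otimes\wedge^2V^*$ (skew-symmetric bilinear maps $V\times V\to V$) by $(A\cdot\mu)(X,Y)=A^{-1}(\mu(AX,AY))$. The null cone is $$\mathcal{N}=\{\mu\in\mathcal{V}:\ \mu\text{ satisfies the Jacobi identity and } 0\in\overline{O(p,q)\cdot\mu}\},$$ where the closure of the orbit is taken in the usual topology of the finite-dimensional real vector space $\mathcal{V}$. Here $V$ is the underlying vector space of $\mathfrak{s}$. *)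

(* Defs.v *)
From HB Require Import structures.
From mathcomp Require Import all_boot all_order all_algebra.
From mathcomp Require Import all_classical all_reals all_analysis.

Set Implicit Arguments.
Unset Strict Implicit.
Unset Printing Implicit Defensive.

Import GRing.Theory VectorInternalTheory.
Import numFieldNormedType.Exports.

Local Open Scope classical_set_scope.
Local Open Scope ring_scope.

Section LieAlgebras.
Variables (R : realType) (V : vectType R).

(* A bilinear map V x V -> V in curried form: mu x y is the value at (x, y). *)
Definition bilinear_map := 'Hom(V, 'Hom(V, V)).

Implicit Types (mu : bilinear_map) (U : {vspace V}).

Definition skew_map mu := forall x y, mu x y = - mu y x.

Definition jacobi mu :=
  forall x y z, mu x (mu y z) + mu y (mu z x) + mu z (mu x y) = 0.

Definition lie_bracket mu := skew_map mu /\ jacobi mu.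

Definition lie_ideal mu U := forall x u, u \in U -> mu x u \in U.

Definition completely_solvable mu :=
  let n := \dim {:V} in
  exists a : nat -> {vspace V},
    [/\ a 0%N = fullv, a n = 0%VS,
        forall i, (i <= n)%N -> lie_ideal mu (a i) &
        forall i, (i < n)%N ->
          (a i.+1 <= a i)%VS /\ (\dim (a i) - \dim (a i.+1) = 1)%N].

End LieAlgebras.

(* A finite-dimensional real vector space carries the topology transported from
   'rV[R]_n by the coordinate isomorphism v2r; since linear automorphisms of
   R^n are homeomorphisms, it does not depend on the choice of coordinates. *)
Definition vect_closure (R : realType) (W : vectType R) (S : set W) : set W :=
  @closure (initial_topology (v2r : W -> 'rV[R]_(dim W))) S.

Section NullCone.
Variables (R : realType) (V : vectType R).
Implicit Types (g : {symmetric V}) (A : 'End(V)) (mu : bilinear_map V).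

(* p is the number of positive squares and q that of negative ones. *)
Definition has_signature g (p q : nat) :=
  exists2 e : (p + q).-tuple V, basis_of fullv e &
    forall i j : 'I_(p + q),
      g e`_i e`_j = if i == j then (if (i < p)%N then 1 else -1) else 0.

Definition orthogonal_group g : set 'End(V) :=
  [set A | lker A = 0%VS /\ isometry g g A].

(* The value of linfun is meaningful because the map below is linear, see
   lie_actE. *)
Definition lie_act A mu : bilinear_map V :=
  linfun (fun x => (A^-1 \o mu (A x) \o A)%VF).

Lemma lie_actE A mu x y : lie_act A mu x y = (A^-1)%VF (mu (A x) (A y)).
Proof.
pose f x := (A^-1 \o mu (A x) \o A)%VF.
have f_linear : linear f.
  move=> a u v; apply/lfunP => z; rewrite /f.
  by rewrite !(comp_lfunE, add_lfunE, scale_lfunE, linearP).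
pose fL := GRing.isLinear.Build _ _ _ _ f f_linear.
pose F : {linear V -> 'Hom(V, V)} := HB.pack f fL.
by rewrite /lie_act -[linfun _]/(linfun F) lfunE /= !comp_lfunE.
Qed.

Definition orthogonal_orbit g mu : set (bilinear_map V) :=
  [set lie_act A mu | A in orthogonal_group g].

(* The closure is taken among all bilinear maps.  When mu is skew-symmetric so
   is its orbit, and the usual topology of the linear subspace of
   skew-symmetric maps is the induced one, so membership of 0 is unaffected. *)
Definition null_cone g : set (bilinear_map V) :=
  [set mu | [/\ skew_map mu, jacobi mu &
                vect_closure (orthogonal_orbit g mu) (0 : bilinear_map V)]].

End NullCone.

(* Main.v *)
Require Import Defs.
From HB Require Import structures.
From mathcomp Require Import all_boot all_order all_algebra.
From mathcomp Require Import all_classical all_reals all_analysis.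
From mathcomp Require Import zify ring lra.

(* Let a_0 > a_1 > ... > a_n = 0 be a complete flag of ideals and let M be the
   set of x such that ad x maps every a_i into a_(i+1).  M contains all brackets,
   and n <= 2 dim M: the weight of ad on the line a_i / a_(i+1) can be nonzero
   only if M meets a_i outside a_(i+1), so at most dim M linear conditions
   define M.  Hence s has a basis e_0, ..., e_(n-1), a complement of M followed
   by a basis of M compatible with the flag, such that for i < j the bracket
   [e_i, e_j] lies in span(e_j, ..., e_(n-1)), and even in
   span(e_(j+1), ..., e_(n-1)) as soon as 2 i + 1 >= n.
   Pair e_i with e_(n-1-i).  With weights w_i = 2^(n-1-i) on the first half,
   -2^i on the second half and 0 in the middle, the maps e_i |-> s^(w_i) e_i are
   isometries, and they multiply every nonzero structure constant by
   s^(w_i + w_j - w_k) with a positive exponent; let s tend to 0. *)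

Set Implicit Arguments.
Unset Strict Implicit.
Unset Printing Implicit Defensive.

Import Order.TTheory GRing.Theory Num.Theory VectorInternalTheory.
Import numFieldNormedType.Exports.

Local Open Scope ring_scope.

(** * Flags of ideals, their weights, and a basis adapted to them *)

Lemma subrACA (Z : zmodType) (x y z t : Z) :
  (x - y) - (z - t) = (x - z) - (y - t).
Proof. by rewrite !opprD addrACA. Qed.

Section Flags.
Variables (R : realType) (V : vectType R) (mu : bilinear_map V).
Implicit Types (U W N : {vspace V}).

Lemma vspace_codim1 U W : (U <= W)%VS -> (\dim W - \dim U = 1)%N ->
  exists2 v, v \in W & forall u, u \in W -> exists c, u - c *: v \in U.
Proof.
move=> sUW dimW; have : ~~ (W <= U)%VS.
  by apply/negP => /dimvS; lia.
case/subvPn => v vW vU; exists v => // u uW.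
have vn0 : v != 0 by apply: contraNneq vU => ->; rewrite mem0v.
have UvW : (U + <[v]> = W)%VS.
  apply/eqP; rewrite eqEdim subv_add sUW -memvE vW /=.
  rewrite dimv_disjoint_sum; first by rewrite dim_vline vn0; lia.
  apply/eqP; rewrite -subv0; apply/subvP => x /memv_capP[xU /vlineP[c xE]].
  rewrite memv0 xE scaler_eq0; apply/orP; left; apply: contraNT vU => c0.
  by rewrite -(scalerK c0 v) -xE rpredZ.
move: uW; rewrite -UvW => /memv_addP[w wU [_ /vlineP[c ->] ->]].
by exists c; rewrite addrK.
Qed.

Hypothesis mu_lie : lie_bracket mu.

Section Quotient.
Variables U W : {vspace V}.
Hypotheses (U_ideal : lie_ideal mu U) (W_ideal : lie_ideal mu W).
Hypotheses (sUW : (U <= W)%VS) (dimWU : (\dim W - \dim U = 1)%N).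

(** Since [W / U] is a line, [ad x] acts on it by a scalar, read off from a spanning vector [v]. *)
Lemma quotient_weight x :
  exists a, forall u, u \in W -> mu x u - a *: u \in U.
Proof.
have [v vW vP] := vspace_codim1 sUW dimWU.
have [a aP] := vP _ (W_ideal x vW); exists a => u /vP[c cP].
have -> : mu x u - a *: u = mu x (u - c *: v) - a *: (u - c *: v)
    + c *: (mu x v - a *: v).
  rewrite [mu x (u - _)]linearB /= [mu x (c *: v)]linearZ /=.
  rewrite !scalerBr !scalerA [a * c]mulrC.
  by rewrite subrACA subrK.
by rewrite rpredD ?rpredB ?rpredZ //; apply: U_ideal.
Qed.

(** Scalars on the line [W / U] commute, so by the Jacobi identity [ad] of a bracket acts on it by
    0. *)
Lemma bracket_quotient x y u : u \in W -> mu (mu x y) u \in U.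
Proof.
move=> uW; have [skew jac] := mu_lie.
have [a aP] := quotient_weight x; have [b bP] := quotient_weight y.
have -> : mu (mu x y) u = mu x (mu y u) - mu y (mu x u).
  rewrite [LHS]skew; apply/eqP; rewrite eq_sym -addr_eq0; apply/eqP.
  by rewrite -[RHS](jac x y u) (skew u x) linearN.
have -> : mu x (mu y u) - mu y (mu x u) =
    mu x (mu y u - b *: u) - mu y (mu x u - a *: u)
    + (b *: (mu x u - a *: u) - a *: (mu y u - b *: u)).
  rewrite [mu x (_ - _)]linearB [mu y (_ - _)]linearB /=.
  rewrite [mu x (b *: u)]linearZ [mu y (a *: u)]linearZ /=.
  rewrite !scalerBr !scalerA [b * a]mulrC.
  by rewrite subrACA (subrACA (b *: _)) subrr subr0 subrK.
by rewrite rpredD ?rpredB ?rpredZ ?aP ?bP // U_ideal ?aP ?bP.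
Qed.

(** [N] is the kernel of the weight of [ad] on [W / U]. This weight is a linear form, so its kernel
    cuts the dimension of any [M] by at most one. *)
Lemma quotient_centralizer : exists N : {vspace V},
  (forall x, x \in N <-> (forall u, u \in W -> mu x u \in U)) /\
  (forall M, (\dim M <= \dim (N :&: M)%VS + 1)%N).
Proof.
have [skew _] := mu_lie; have [v vW vP] := vspace_codim1 sUW dimWU.
(* [pi] has kernel [U] and stands in for the quotient map. It sends [W] to a line, so [f], which
   represents minus the weight, has rank at most one. *)
pose pi := (\1 - projv U)%VF.
have kerpi w : (w \in lker pi) = (w \in U).
  rewrite memv_ker !lfunE /= !lfunE /= subr_eq0; apply/eqP/idP => [->|wU].
    exact: memv_proj.
  by rewrite projv_id.
pose f := (pi \o mu v)%VF.
have kerf x : (x \in lker f) = (mu v x \in U).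
  by rewrite -kerpi !memv_ker comp_lfunE.
exists (lker f); split=> [x | M].
  rewrite kerf; split=> [vx u /vP[c cP] | xP]; last by rewrite skew rpredN xP.
  rewrite -(subrK (c *: v) u) [mu x _]linearD /= [mu x (c *: v)]linearZ /=.
  rewrite rpredD ?rpredZ //.
    exact: U_ideal.
  by rewrite skew rpredN.
rewrite capvC -(limg_ker_dim f M) capvC leq_add2l.
apply: (@leq_trans (\dim (pi @: W))).
  apply/dimvS/subvP => _ /memv_imgP[x _ ->].
  by rewrite comp_lfunE memv_img // skew rpredN W_ideal.
have := limg_ker_dim pi W.
suff -> : (W :&: lker pi)%VS = U by lia.
apply/vspaceP => w; rewrite memv_cap kerpi andb_idl //.
exact: (subvP sUW).
Qed.

End Quotient.

Variable a : nat -> {vspace V}.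
Hypotheses (a0 : a 0 = fullv) (an : a (\dim {:V}) = 0%VS).
Hypothesis a_ideal : forall i, (i <= \dim {:V})%N -> lie_ideal mu (a i).
Hypothesis a_step : forall i, (i < \dim {:V})%N ->
  (a i.+1 <= a i)%VS /\ (\dim (a i) - \dim (a i.+1) = 1)%N.

(** Equivalently, all weights of [x] along the flag vanish. *)
Definition flag_nilpotent x :=
  forall i, (i < \dim {:V})%N -> forall u, u \in a i -> mu x u \in a i.+1.

Lemma flag_nilpotent_bracket x y : flag_nilpotent (mu x y).
Proof.
move=> i lt_in u ui; have [sa da] := a_step lt_in.
exact: bracket_quotient (a_ideal lt_in) (a_ideal (ltnW lt_in)) sa da _ _ _ ui.
Qed.

Lemma flag_nilpotent_space : exists M : {vspace V},
  (forall x, x \in M <-> flag_nilpotent x) /\ (\dim {:V} <= 2 * \dim M)%N.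
Proof.
have /choice[K KP] i : exists N : {vspace V}, (i < \dim {:V})%N ->
  (forall x, x \in N <-> (forall u, u \in a i -> mu x u \in a i.+1)) /\
  (forall M, (\dim M <= \dim (N :&: M)%VS + 1)%N).
  case: (ltnP i (\dim {:V})) => [lt_in | _]; last by exists fullv.
  have [sa da] := a_step lt_in.
  have [N NP] :=
    quotient_centralizer (a_ideal lt_in) (a_ideal (ltnW lt_in)) sa da.
  by exists N.
set n := \dim {:V} in KP *.
pose M := (\bigcap_(j < n) K j)%VS; exists M.
have MP x : x \in M <-> flag_nilpotent x.
  rewrite memvE; split=> [/subv_bigcapP xM i lt_in | nx].
    by apply/(KP i lt_in).1; have := xM (Ordinal lt_in) isT; rewrite -memvE.
  by apply/subv_bigcapP => i _; rewrite -memvE; apply/(KP i (ltn_ord i)).1/nx.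
split=> //.
have brM x y : mu x y \in M by apply/MP/flag_nilpotent_bracket.
(* Induction from the bottom of the flag: [N] collects the last [k] weight kernels. For [k = n] it
   equals [M], and [a 0] is the whole space, which gives [n <= 2 * \dim M]. *)
suff H k : (k <= n)%N -> exists N : {vspace V},
    (forall x, x \in N <-> forall j, (n - k <= j < n)%N -> x \in K j) /\
    (n <= \dim N + \dim (a (n - k) :&: M))%N.
  have [N [NP]] := H n (leqnn n); rewrite subnn a0 capfv.
  have -> : N = M; last by lia.
  apply/vspaceP => x; apply/idP/idP => [/NP xN | xM].
    by rewrite memvE; apply/subv_bigcapP => i _; rewrite -memvE xN ?subnn /=.
  apply/NP => j /andP[_ lt_jn].
  move: xM; rewrite memvE => /subv_bigcapP/(_ (Ordinal lt_jn) isT).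
  by rewrite -memvE.
elim: k => [|k IHk] lt_kn.
  exists fullv; split=> [x|]; last by rewrite leq_addr.
  by rewrite memvf; split=> // _ j; lia.
have [N [NP dimN]] := IHk (ltnW lt_kn); set i := (n - k.+1)%N.
have Ei : (n - k)%N = i.+1 by rewrite /i; lia.
have lt_in : (i < n)%N by rewrite /i; lia.
rewrite Ei in NP dimN; have [KiP KiD] := KP i lt_in.
have [sa _] := a_step lt_in.
exists (K i :&: N)%VS; split=> [x|].
  rewrite memv_cap; split=> [/andP[xK /NP xN] j /andP[le_ij lt_jn] | xP].
    by case: (ltngtP i j) le_ij => // [lt_ij | <-] _ //; rewrite xN ?lt_ij.
  rewrite xP ?leqnn //=; apply/NP => j /andP[ltij ltj].
  by rewrite xP // ltj ltnW.
have sc : (a i.+1 :&: M <= a i :&: M)%VS by rewrite capvS.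
(* If [a i] and [a i.+1] have the same intersection with [M], brackets landing in [a i] already lie
   in [a i.+1], so the weight is zero and [N] is unchanged. Otherwise [N] loses at most one
   dimension while the other summand gains at least one. *)
case: (boolP (a i :&: M <= a i.+1 :&: M)%VS) => [sc' | nsc].
  have -> : K i = fullv.
    apply/vspaceP => x; rewrite memvf; apply/KiP => u ui.
    have : mu x u \in (a i :&: M)%VS.
      by rewrite memv_cap brM (a_ideal (ltnW lt_in)).
    by move/(subvP sc'); rewrite memv_cap => /andP[].
  by rewrite capfv (leq_trans dimN) // leq_add2l dimvS.
have := KiD N; have : (\dim (a i.+1 :&: M) < \dim (a i :&: M))%N.
  rewrite ltn_neqAle dimvS // andbT; apply: contra nsc => /eqP E.
  by rewrite -(geq_leqif (dimv_leqif_sup sc)) E.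
by lia.
Qed.

(** Climbing the flag, a vector is prepended each time [a i] meets [M] in more than [a i.+1] does,
    so that every [a i :&: M] is spanned by a tail of [X]. *)
Lemma triangular_basis (M : {vspace V}) :
    (forall x, x \in M <-> flag_nilpotent x) -> exists X : seq V,
  [/\ basis_of M X,
      forall s j, (j < size X)%N -> mu s X`_j \in <<drop j X>>%VS &
      forall s j, s \in M -> (j < size X)%N ->
        mu s X`_j \in <<drop j.+1 X>>%VS].
Proof.
move=> MP; pose n := \dim {:V}.
have brM x y : mu x y \in M by apply/MP/flag_nilpotent_bracket.
suff H k : (k <= n)%N -> exists X : seq V,
    [/\ basis_of (a (n - k) :&: M) X,
      forall s j, (j < size X)%N -> mu s X`_j \in <<drop j X>>%VS &
      forall s j, s \in M -> (j < size X)%N ->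
        mu s X`_j \in <<drop j.+1 X>>%VS].
  by have := H n (leqnn n); rewrite subnn a0 capfv.
elim: k => [|k IHk] lt_kn.
  by exists [::]; split=> //; rewrite subn0 an cap0v nil_basis.
have [X [bX X1 X2]] := IHk (ltnW lt_kn); set i := (n - k.+1)%N.
have Ei : (n - k)%N = i.+1 by rewrite /i; lia.
have lt_in : (i < n)%N by rewrite /i; lia.
rewrite Ei in bX; have [sa da] := a_step lt_in.
have sc : (a i.+1 :&: M <= a i :&: M)%VS by rewrite capvS.
case: (boolP (a i :&: M <= a i.+1 :&: M)%VS) => [sc' | /subvPn[v]].
  exists X; split=> //; rewrite (_ : (_ :&: _)%VS = (a i.+1 :&: M)%VS) //.
  by apply/eqP; rewrite eqEsubv sc'.
rewrite !memv_cap => /andP[vi vM]; rewrite vM andbT => vi1.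
have spX := span_basis bX.
have bvX : basis_of (a i :&: M) (v :: X).
  have fvX : free (v :: X).
    by rewrite free_cons spX memv_cap vM andbT vi1 (basis_free bX).
  rewrite basisEfree fvX span_cons spX subv_add sc -memvE memv_cap vi vM /=.
  rewrite -(eqnP (basis_free bX)) spX.
  (* The dimension formula shows that the intersection with [M] grows by at most one, so the single
     vector [v] is enough. *)
  have := dimv_sum_cap (a i.+1) (a i :&: M).
  rewrite capvA (capv_idPl sa).
  have : (\dim (a i.+1 + a i :&: M) <= \dim (a i))%N.
    by rewrite dimvS // subv_add sa capvSl.
  by lia.
(* Only [v] is new: its brackets lie in [a i :&: M], and those with elements of [M] in
   [a i.+1 :&: M], the span of [X]. *)
exists (v :: X); split=> //.
  move=> s [|j] /= lt_j; last exact: X1.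
  by rewrite (span_basis bvX) memv_cap brM (a_ideal (ltnW lt_in)).
move=> s [|j] sM /= lt_j; last exact: X2.
by rewrite drop0 spX memv_cap brM andbT; apply/(MP s).1.
Qed.

End Flags.

(** A basis of a complement of [M] is put in front of the triangular basis of [M]; [d] is the
    codimension of [M], at most half the dimension. *)
Lemma solvable_adapted_basis (R : realType) (V : vectType R)
    (mu : bilinear_map V) :
  lie_bracket mu -> completely_solvable mu ->
  exists (e : (\dim {:V}).-tuple V) (d : nat),
    [/\ basis_of fullv e, (2 * d <= \dim {:V})%N,
        forall x j, (j < \dim {:V})%N -> mu x e`_j \in <<drop j e>>%VS &
        forall i j, (d <= i < \dim {:V})%N -> (j < \dim {:V})%N ->
          mu e`_i e`_j \in <<drop j.+1 e>>%VS].
Proof.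
move=> mu_lie [a [a0 an a_ideal a_step]].
have [M [MP dimM]] := flag_nilpotent_space mu_lie a0 a_ideal a_step.
have [X [bX X1 X2]] := triangular_basis mu_lie a0 an a_ideal a_step MP.
set n := \dim {:V} in a_ideal a_step dimM *.
have brM x y : mu x y \in M.
  by apply/MP; apply: (flag_nilpotent_bracket mu_lie a_ideal a_step).
pose Y := vbasis M^C; pose d := size Y.
have bYX : basis_of fullv (Y ++ X).
  rewrite -(addv_complf M) addvC; apply: cat_basis bX; last exact: vbasisP.
  by rewrite directvE /= dimv_disjoint_sum // capvC capv_compl.
have szYX : size (Y ++ X) == n.
  by rewrite -(eqnP (basis_free bYX)) (span_basis bYX).
have sz : n = (d + size X)%N by rewrite -(eqP szYX) size_cat.
have szX : size X = \dim M.
  by rewrite -(span_basis bX) (eqnP (basis_free bX)).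
exists (Tuple szYX), d; split=> //=; first by lia.
  (* A tail starting at or before position [d] contains all of [X], hence spans a space containing
     [M] and every bracket. Below, this also covers the boundary case [j.+1 = d]. *)
  move=> x j lt_jn; rewrite nth_cat drop_cat -/d; case: ltnP => le_jd.
    by rewrite span_cat; apply: (subvP (addvSr _ _)); rewrite (span_basis bX).
  by apply: X1; lia.
move=> i j /andP[le_di lt_in] lt_jn; rewrite !nth_cat drop_cat -/d.
case: (ltnP j d) => le_jd.
  case: (ltnP j.+1 d) => le_j1d.
    by rewrite span_cat; apply: (subvP (addvSr _ _)); rewrite (span_basis bX).
  by rewrite (_ : j.+1 - d = 0)%N ?drop0 ?(span_basis bX) //; lia.
have lt_idX : (i - d < size X)%N by lia.
have XM : X`_(i - d) \in M by rewrite -(span_basis bX) memv_span ?mem_nth.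
by rewrite ltnNge le_di ltnNge leqW //= subSn //; apply: X2 => //; lia.
Qed.

(** * A norm criterion for 0 to lie in a closure *)

Lemma vect_closure0 (R : realType) (W : vectType R) (S : set W) :
    (forall eps : R, 0 < eps -> exists2 x, S x & `|v2r x| < eps) ->
  vect_closure S 0.
Proof.
move=> S_small B; rewrite nbhsE /= => -[_ [[C openC <-] C0] CB].
have /nbhs_ballP[eps eps_gt0 ballC] : nbhs (v2r (0 : W)) C.
  exact: open_nbhs_nbhs.
have [x Sx x_lt] := S_small eps eps_gt0; exists x; split=> //.
by apply/CB/ballC; rewrite -ball_normE /= linear0 sub0r normrN.
Qed.

(** * The antidiagonal form, its diagonal isometries and its signature *)

Section AntidiagonalForm.
Variables (R : realType) (V : vectType R) (n : nat) (e : n.-tuple V).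
Hypothesis e_basis : basis_of fullv e.

(** The minus sign makes the self-paired middle vector of an odd-dimensional space negative, as
    signature [(p, p + 1)] requires. *)
Definition antidiag_form (x y : V) : R :=
  - \sum_(i < n) coord e i x * coord e (rev_ord i) y.

Lemma antidiag_formC x y : antidiag_form x y = antidiag_form y x.
Proof.
congr (- _); rewrite (reindex_inj rev_ord_inj) /=.
by apply: eq_bigr => i _; rewrite rev_ordK mulrC.
Qed.

Fact antidiag_form_linearr x : linear_for *%R (antidiag_form x).
Proof.
move=> c u v; rewrite /antidiag_form mulrN -opprD mulr_sumr -big_split /=.
congr (- _); apply: eq_bigr => i _; rewrite linearP /=; ring.
Qed.

Fact antidiag_form_bilinear :
  bilinear_for (GRing.Scale.Law.clone _ _ *%R _)
    (GRing.Scale.Law.clone _ _ (idfun \; *%R) _) antidiag_form.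
Proof.
split=> [u' | u] c x y /=; last exact: antidiag_form_linearr.
by rewrite ![antidiag_form _ u']antidiag_formC antidiag_form_linearr.
Qed.

HB.instance Definition _ := bilinear_isBilinear.Build R V V R _ _ antidiag_form
  antidiag_form_bilinear.

Fact antidiag_form_hermitian x y :
  antidiag_form x y = (-1) ^+ false * idfun (antidiag_form y x).
Proof. by rewrite expr0 mul1r antidiag_formC. Qed.

HB.instance Definition _ := isHermitianSesquilinear.Build R V false idfun
  antidiag_form antidiag_form_hermitian.

Definition antidiag : {symmetric V} := antidiag_form.

Lemma antidiag_coord u (j : 'I_n) : antidiag u e`_j = - coord e (rev_ord j) u.
Proof.
rewrite /antidiag /= /antidiag_form (bigD1 (rev_ord j)) //= big1 => [|k kj].
  by rewrite addr0 coord_free ?(basis_free e_basis) // rev_ordK eqxx mulr1.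
rewrite coord_free ?(basis_free e_basis) // -(inj_eq rev_ord_inj) rev_ordK eq_sym.
by rewrite (negPf kj) mulr0.
Qed.

Lemma antidiag_basis (i j : 'I_n) :
  antidiag e`_i e`_j = - (i == rev_ord j)%:R.
Proof. by rewrite antidiag_coord coord_free // (basis_free e_basis). Qed.

Lemma antidiag_nondegenerate : nondegenerate antidiag.
Proof.
apply/eqP/vspaceP => u; rewrite memv0; apply/idP/eqP => [/mem_orthovP u0|->].
  rewrite (coord_basis e_basis (memvf u)) big1 // => i _.
  have /eqP := u0 e`_(rev_ord i) (memvf _).
  by rewrite antidiag_coord rev_ordK oppr_eq0 => /eqP->; rewrite scale0r.
by rewrite mem0v.
Qed.

Lemma free_of_orthogonal (g : {symmetric V}) (f : n.-tuple V) :
    (forall i j : 'I_n, i != j -> g f`_i f`_j = 0) ->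
    (forall i : 'I_n, g f`_i f`_i != 0) ->
  free f.
Proof.
move=> f_orth f_neq0; apply/freeP => k k0 i.
have : g (\sum_(j < n) k j *: f`_j) f`_i = 0 by rewrite k0 linear0l.
rewrite linear_sumlz (bigD1 i) //= big1 ?addr0 => [|j ji].
  rewrite linearZl_LR /= => /eqP.
  by rewrite mulf_eq0 (negPf (f_neq0 i)) orbF => /eqP.
by rewrite linearZl_LR /= f_orth ?mulr0.
Qed.

(** Serves to diagonalise the form separately on each plane spanned by a basis vector and its
    partner. *)
Lemma antidiag_gram (a b : 'I_n -> R) (i j : 'I_n) :
  antidiag (a i *: e`_i + b i *: e`_(rev_ord i))
           (a j *: e`_j + b j *: e`_(rev_ord j)) =
  - ((i == rev_ord j)%:R * (a i * a j + b i * b j) +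
     (i == j)%:R * (a i * b j + b i * a j)).
Proof.
have expand (u v u' v' : V) (c d c' d' : R) :
    antidiag (c *: u + d *: v) (c' *: u' + d' *: v') =
    c * c' * antidiag u u' + c * d' * antidiag u v'
    + d * c' * antidiag v u' + d * d' * antidiag v v'.
  set rhs := RHS; rewrite linearDl !linearDr /= !linearZl_LR !linearZr_LR /= /rhs.
  ring.
rewrite expand !antidiag_basis.
rewrite !rev_ordK (inj_eq rev_ord_inj) (can2_eq (@rev_ordK n) (@rev_ordK n)).
ring.
Qed.

Definition diag_lfun (c : 'I_n -> R) : 'End(V) :=
  linfun (sval (linear_of_free e [seq c i *: e`_i | i <- enum 'I_n])).

Lemma coord_diag_lfun c i x : coord e i (diag_lfun c x) = c i * coord e i x.
Proof.
have e_free := basis_free e_basis.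
have diagE (j : 'I_n) : diag_lfun c e`_j = c j *: e`_j.
  rewrite lfunE /=; case: linear_of_free => /= f.
  rewrite size_map size_enum_ord size_tuple => /(_ e_free erefl) fE.
  rewrite -(nth_map _ 0) ?size_tuple // fE (nth_map j) ?size_enum_ord //.
  by rewrite nth_ord_enum.
rewrite {1}(coord_basis e_basis (memvf x)) linear_sum /= linear_sum (bigD1 i) //=.
rewrite linearZ /= diagE !linearZ /= coord_free // eqxx mulr1 mulrC.
rewrite big1 ?addr0 // => j ji.
by rewrite linearZ /= diagE !linearZ /= coord_free // (negPf ji) !mulr0.
Qed.

Lemma coord_eq x y : (forall i, coord e i x = coord e i y) -> x = y.
Proof.
move=> xy; rewrite (coord_basis e_basis (memvf x)).
rewrite (coord_basis e_basis (memvf y)).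
by apply: eq_bigr => i _; rewrite xy.
Qed.

Lemma lker_diag_lfun c : (forall i, c i != 0) -> lker (diag_lfun c) == 0%VS.
Proof.
move=> c0; apply/lker0P => x y xy; apply: coord_eq => i.
by apply: (mulfI (c0 i)); rewrite -!coord_diag_lfun xy.
Qed.

Lemma coord_diag_lfunV c i x : (forall i, c i != 0) ->
  coord e i ((diag_lfun c)^-1%VF x) = (c i)^-1 * coord e i x.
Proof.
move=> c0; apply: (mulfI (c0 i)); rewrite mulVKf //.
by rewrite -coord_diag_lfun lker0_lfunVK ?lker_diag_lfun.
Qed.

Lemma diag_lfun_orthogonal c : (forall i, c i * c (rev_ord i) = 1) ->
  orthogonal_group antidiag (diag_lfun c).
Proof.
move=> c1; split.
  apply/eqP/lker_diag_lfun => i; apply: contra_eqN (c1 i) => /eqP->.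
  by rewrite mul0r eq_sym oner_eq0.
move=> x y; rewrite /antidiag /= /antidiag_form; congr (- _).
apply: eq_bigr => i _; rewrite !coord_diag_lfun mulrACA c1 mul1r //.
Qed.

(** The elementary tensors in which a bracket is expanded by its structure constants; they need not
    be skew. *)
Definition coord_bilinear (v : V) (i j : 'I_n) : bilinear_map V :=
  linfun (fun x => linfun (fun y => (coord e i x * coord e j y) *: v)).

Lemma coord_bilinearE v i j x y :
  coord_bilinear v i j x y = (coord e i x * coord e j y) *: v.
Proof.
pose f1 (x y : V) := (coord e i x * coord e j y) *: v.
have f1_lin z : linear (f1 z).
  move=> a u w; rewrite /f1 linearP /= mulrDr scalerDl scalerA; congr (_ *: v + _).
  by ring.
pose F1 z : {linear V -> V} :=
  HB.pack (f1 z) (GRing.isLinear.Build _ _ _ _ _ (f1_lin z)).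
have F1E z w : linfun (f1 z) w = f1 z w.
  by rewrite -[f1 z]/(F1 z : V -> V) lfunE.
pose f2 z := linfun (f1 z).
have f2_lin : linear f2.
  move=> a u w; apply/lfunP => z; rewrite /f2 !(add_lfunE, scale_lfunE, F1E) /f1.
  by rewrite linearP /= mulrDl scalerDl !scalerA mulrA.
pose F2 : {linear V -> 'Hom(V, V)} :=
  HB.pack f2 (GRing.isLinear.Build _ _ _ _ _ f2_lin).
have F2E z : linfun f2 z = f2 z by rewrite -[f2]/(F2 : V -> _) lfunE.
by rewrite /coord_bilinear -[X in linfun X]/f2 F2E /f2 F1E.
Qed.

(** Scaling the arguments contributes [c i * c j], and the inverse map divides the [k]-th coordinate
    of the value by [c k]. *)
Lemma lie_act_diag c (mu : bilinear_map V) : (forall i, c i != 0) ->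
  lie_act (diag_lfun c) mu = \sum_i \sum_j \sum_k (c i * c j / c k) *:
    coord_bilinear (coord e k (mu e`_i e`_j) *: e`_k) i j.
Proof.
move=> c0; apply/lfunP => x; apply/lfunP => y; rewrite lie_actE.
apply: coord_eq => l; rewrite coord_diag_lfunV //.
set x' := diag_lfun c x; set y' := diag_lfun c y.
have -> : mu x' y' = \sum_i \sum_j
    (c i * c j * (coord e i x * coord e j y)) *: mu e`_i e`_j.
  rewrite (coord_basis e_basis (memvf x')) linear_sum sum_lfunE.
  apply: eq_bigr => i _; rewrite linearZ scale_lfunE /=.
  rewrite [in LHS](coord_basis e_basis (memvf y')) linear_sum scaler_sumr.
  apply: eq_bigr => j _; rewrite linearZ /= scalerA !coord_diag_lfun.
  by congr (_ *: _); ring.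
rewrite !sum_lfunE !linear_sum /= mulr_sumr; apply: eq_bigr => i _.
rewrite !sum_lfunE !linear_sum /= mulr_sumr; apply: eq_bigr => j _.
rewrite !sum_lfunE !linear_sum /= (bigD1 l) //= big1 ?addr0 => [|k kl].
  rewrite !scale_lfunE coord_bilinearE !linearZ /=.
  rewrite coord_free ?(basis_free e_basis) // eqxx mulr1; ring.
rewrite !scale_lfunE coord_bilinearE !linearZ /=.
by rewrite coord_free ?(basis_free e_basis) // (negPf kl) !mulr0.
Qed.

End AntidiagonalForm.

Lemma antidiag_signature (R : realType) (V : vectType R) (n : nat)
    (e : n.-tuple V) (p q : nat) :
    basis_of fullv e -> n = (p + q)%N -> (p <= q <= p + 1)%N ->
  has_signature (antidiag e) p q.
Proof.
move=> e_basis n_eq pq; subst n.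
(* With [i' = rev_ord i], the vectors are [e_i - e_i' / 2] of square 1 for [i < i'],
   [e_i' + e_i / 2] of square -1 for [i' < i], and the middle [e_i] of square -1. As
   [p <= q <= p + 1], the first case is exactly [i < p]. *)
pose a (i : 'I_(p + q)) : R := if (rev_ord i < i)%N then 2^-1 else 1.
pose b (i : 'I_(p + q)) : R :=
  if (i < rev_ord i)%N then - 2^-1 else if (rev_ord i < i)%N then 1 else 0.
pose f := [tuple a i *: e`_i + b i *: e`_(rev_ord i) | i < p + q].
have fE (i : 'I_(p + q)) : f`_i = a i *: e`_i + b i *: e`_(rev_ord i).
  by rewrite -tnth_nth tnth_mktuple.
have gram (i j : 'I_(p + q)) : antidiag e f`_i f`_j =
    if i == j then (if (i < p)%N then 1 else -1) else 0.
  rewrite !fE antidiag_gram //; have [-> | nij] := eqVneq i j.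
    rewrite -val_eqE /a /b /=; have := ltn_ord j.
    case: (ltnP j p) => jp lt_j.
      have -> : (j < p + q - j.+1)%N by lia.
      have -> : (p + q - j.+1 < j)%N = false by lia.
      have -> : (j == p + q - j.+1 :> nat)%N = false by lia.
      by rewrite mul0r add0r mul1r; field.
    have -> : (j < p + q - j.+1)%N = false by lia.
    case: ltnP => [lt|ge].
      have -> : (j == p + q - j.+1 :> nat)%N = false by lia.
      by rewrite mul0r add0r mul1r; field.
    have -> : (j == p + q - j.+1 :> nat)%N by lia.
    by rewrite !mul1r !mulr0 mul0r !addr0.
  case: eqVneq => [ij | _]; last by rewrite !mul0r addr0 oppr0.
  rewrite mul0r addr0 mul1r {i}ij in nij *; move: nij.
  rewrite -val_eqE /a /b rev_ordK /=; case: ltngtP => // _ _; by field.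
exists f => //; rewrite basisEfree subvf size_tuple -{2}(size_tuple e).
rewrite -(eqnP (basis_free e_basis)) (span_basis e_basis) leqnn !andbT.
apply: (free_of_orthogonal (g := antidiag e)) => [i j /negPf ij | i].
  by rewrite gram ij.
by rewrite gram eqxx; case: ifP => _; rewrite ?oppr_eq0 oner_eq0.
Qed.

(** * Exponents of the one-parameter family of isometries *)

(** The tests compare [i] with its partner [n - 1 - i]. *)
Definition weight (n i : nat) : int :=
  if (2 * i + 1 < n)%N then (2 ^ (n - i.+1))%N%:Z
  else if (2 * i + 1 == n)%N then 0 else - (2 ^ i)%N%:Z.

Lemma weight_rev n i : (i < n)%N -> weight n i + weight n (n - i.+1) = 0.
Proof.
move=> lt_in; rewrite /weight.
have [lt|gt|eq] := ltngtP (2 * i + 1) n.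
- by rewrite !ifF ?addrN; lia.
- by rewrite ifT ?subnSK ?subKn ?addNr; lia.
- by rewrite ifF ?ifT; lia.
Qed.

(** The weights strictly decrease. For [k = j] the claim is that [weight n i] is positive. For
    [j < k] and [i] not past the middle, a nonnegative term is added to a positive difference. For
    [i] past the middle, the claim is [2 ^ i + 2 ^ j < 2 ^ k]; this is where powers of two enter. *)
Lemma weight_gap n i j k : (i < j <= k)%N -> (k < n)%N ->
  (k = j -> 2 * i + 1 < n)%N -> 0 < weight n i + weight n j - weight n k.
Proof.
move=> /andP[lt_ij le_jk] lt_kn kj.
have pow x y : (x < y)%N -> (2 * 2 ^ x <= 2 ^ y)%N by rewrite -expnS leq_exp2l.
have pos x : (0 < 2 ^ x)%N by rewrite expn_gt0.
have decr x y : (x < y < n)%N -> weight n y < weight n x.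
  move=> /andP[lt_xy lt_yn]; have h1 := pow _ _ lt_xy.
  have h2 : (2 * 2 ^ (n - y.+1) <= 2 ^ (n - x.+1))%N by apply: pow; lia.
  have := (pos x, pos y, pos (n - x.+1)%N, pos (n - y.+1)%N).
  move=> [[[p1 p2] p3] p4]; rewrite /weight.
  by case: (ltngtP (2 * x + 1) n) => ?; case: (ltngtP (2 * y + 1) n) => ?; lia.
have [eq_kj|/eqP neq_kj] := eqVneq k j.
  rewrite eq_kj addrK /weight kj //.
  by have := pos (n - i.+1)%N; lia.
have := decr j k; rewrite lt_kn andbT => /(_ _) wjk.
have {}wjk : weight n k < weight n j by apply: wjk; lia.
have [le_in|gt_in] := leqP (2 * i + 1) n.
  have : 0 <= weight n i by rewrite /weight; case: ltngtP le_in; lia.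
  by lia.
rewrite /weight !ifF; [|lia..].
have := (pow _ _ lt_ij, pow j k, pos i); move=> [[h1 h2] h3].
by have {}h2 := h2 ltac:(lia); lia.
Qed.

(** * Contraction of the bracket to 0 by diagonal isometries *)

Theorem proposition6p3 (R : realType) (V : vectType R) (mu : bilinear_map V)
    (mu_lie : lie_bracket mu) (mu_solv : completely_solvable mu)
    (dim_ge3 : (3 <= \dim {:V})%N) :
  exists g : {symmetric V},
    [/\ nondegenerate g,
        forall p, \dim {:V} = (2 * p)%N -> has_signature g p p,
        forall p, \dim {:V} = (2 * p + 1)%N -> has_signature g p (p + 1)
      & null_cone g mu].
Proof.
have [e [d [e_basis le_dn e1 e2]]] := solvable_adapted_basis mu_lie mu_solv.
have [skew jac] := mu_lie.
exists (antidiag e); split.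
- exact: antidiag_nondegenerate.
- by move=> p dimV; apply: antidiag_signature => //; lia.
- by move=> p dimV; apply: antidiag_signature => //; lia.
split=> //; apply: vect_closure0 => eps eps_gt0.
move: e e_basis e1 e2; set n := \dim {:V} in le_dn *.
move=> e e_basis e1 e2.
have coord_drop m (k : 'I_n) x :
    x \in <<drop m e>>%VS -> coord e k x != 0 -> (m <= k)%N.
  move=> xm; apply: contraNT; rewrite -ltnNge => lt_km.
  have : (<<drop m e>> <= lker (linfun (coord e k : V -> R^o)))%VS.
    apply/span_subvP => y /(nthP 0)[j]; rewrite size_drop size_tuple => lt_j <-.
    have lt_mj : (m + j < n)%N by lia.
    rewrite memv_ker lfunE /= nth_drop -[(m + j)%N]/(nat_of_ord (Ordinal lt_mj)).
    rewrite coord_free ?(basis_free e_basis) // -val_eqE /=.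
    by rewrite gtn_eqF //; lia.
  by move/subvP/(_ x xm); rewrite memv_ker lfunE.
have coord_neq0 (i j k : 'I_n) : coord e k (mu e`_i e`_j) != 0 ->
    0 < weight n i + weight n j - weight n k.
  wlog lt_ij : i j / (i < j)%N.
    move=> IH ck; have [lt_ij|lt_ji|/val_inj eq_ij] := ltngtP i j.
    - exact: IH.
    - rewrite [weight n i + _]addrC; apply: IH => //.
      by rewrite skew linearN oppr_eq0.
    - move: ck; rewrite eq_ij.
      have -> : mu e`_j e`_j = 0.
        have /eqP := skew e`_j e`_j; rewrite -addr_eq0 -mulr2n -scaler_nat.
        by rewrite scaler_eq0 pnatr_eq0 => /eqP.
      by rewrite linear0 eqxx.
  move=> ck; have le_jk : (j <= k)%N.
    by apply: coord_drop ck; apply: e1.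
  apply: weight_gap; rewrite ?ltn_ord ?lt_ij ?le_jk //.
  (* If [i < d], then [2 * d <= n] puts [i] in the first half. If [d <= i], the bracket falls
     strictly below [e_j] in the basis order, which excludes [k = j]. *)
  have [le_di|lt_id] := leqP d i; last by lia.
  have : (j.+1 <= k)%N; last by lia.
  by apply: coord_drop ck; apply: e2 => //; rewrite le_di ltn_ord.
pose B (i j k : 'I_n) : bilinear_map V :=
  coord_bilinear e (coord e k (mu e`_i e`_j) *: e`_k) i j.
pose C := \sum_i \sum_j \sum_k `|v2r (B i j k)|.
have C_ge0 : 0 <= C by do 3 (apply: sumr_ge0 => ? _); exact: normr_ge0.
(* This choice gives [0 < s <= 1] and [s * C < eps], also when [C = 0]. *)
pose s := eps / (eps + C).
have s_gt0 : 0 < s by rewrite divr_gt0 // ltr_wpDr.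
have s_le1 : s <= 1 by rewrite ler_pdivrMr ?ltr_wpDr // mul1r lerDl.
have sC : s * C < eps.
  rewrite /s mulrAC ltr_pdivrMr ?ltr_wpDr // ltr_pM2l // ltrDr //.
pose c (i : 'I_n) := s ^ weight n i.
have c_neq0 i : c i != 0 by rewrite expfz_neq0 // gt_eqF.
exists (lie_act (diag_lfun e c) mu).
  exists (diag_lfun e c) => //; apply: diag_lfun_orthogonal => // i.
  by rewrite /c -expfzDr ?gt_eqF // weight_rev.
(* Each nonzero component is scaled by a power of [s] with exponent at least 1, hence by at most
   [s]; summing norms bounds the total by [s * C]. *)
rewrite lie_act_diag //; apply: le_lt_trans sC.
rewrite /C mulr_sumr linear_sum; apply: le_trans (ler_norm_sum _ _ _) _.
apply: ler_sum => i _; rewrite mulr_sumr linear_sum.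
apply: le_trans (ler_norm_sum _ _ _) _.
apply: ler_sum => j _; rewrite mulr_sumr linear_sum.
apply: le_trans (ler_norm_sum _ _ _) _.
apply: ler_sum => k _; rewrite linearZ /= -/(B i j k) normrZ.
have [ck0|ck] := eqVneq (coord e k (mu e`_i e`_j)) 0.
  have -> : B i j k = 0.
    apply/lfunP => x; apply/lfunP => y.
    by rewrite coord_bilinearE ck0 scale0r scaler0 !zero_lfunE.
  by rewrite linear0 normr0 !mulr0.
apply: ler_wpM2r => //.
have := coord_neq0 i j k ck.
have -> : c i * c j / c k = s ^ (weight n i + weight n j - weight n k).
  by rewrite /c -expfzDr ?gt_eqF // invr_expz -expfzDr ?gt_eqF.
case: (_ - _) => // -[|w] // _.
rewrite -exprnP normrX gtr0_norm // exprS ler_piMr ?exprn_ile1 ?(ltW s_gt0) //.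
Qed.
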